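(* Let $L=uI+J\subset R=K[x_1,\ldots,x_n]$ be a monomial ideal, where $I,J\subset R$ are monomial ideals and $u\in R$ is a monomial, such that $\mathrm{supp}(u)\cap(\mathrm{supp}(I)\cup\mathrm{supp}(J))=\emptyset$. Then, for all $t\geq 1$, if $\mathfrak{m}\in \mathrm{Ass}(R/L^t)$, then $\mathfrak{m}\in \mathrm{Ass}(R/(L^t,u^t))$.
   Context: Here $K$ is a field, $R=K[x_1,\ldots,x_n]$ is a polynomial ring and $\mathfrak{m}=(x_1,\ldots,x_n)$. For an ideal $Q$ of $R$ and $f\in R$, $(Q,f)$ denotes the ideal $Q+fR$, and $\mathrm{Ass}(R/Q)$ is the set of associated primes of $Q$, i.e. the prime ideals of the form $(Q:f)=\{r\in R\mid rf\in Q\}$ with $f\in R$. For a monomial $u$, $\mathrm{supp}(u)$ is the set of variables dividing $u$ (with $\mathrm{supp}(1)=\emptyset$); for a monomial ideal $I$ with unique minimal set of monomial generators $\mathcal{G}(I)$, $\mathrm{supp}(I)=\bigcup_{v\in\mathcal{G}(I)}\mathrm{supp}(v)$.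
   Formalization: The formal statement additionally assumes u ≠ 1; for u = 1 the claim fails, e.g. R = K[x], I = (x), J = 0, t = 1, where m is associated to L = (x) but (L,u) = R has no associated primes. *)

(* Defs.v *)
From mathcomp Require Import all_boot all_order all_algebra.
From mathcomp Require Import mpoly.
From mathcomp Require Import boolp classical_sets.
Set Implicit Arguments.
Unset Strict Implicit.
Unset Printing Implicit Defensive.
Import GRing.Theory.
Local Open Scope ring_scope.
Local Open Scope classical_set_scope.

Section Ideals.
Variable R : comNzRingType.
Implicit Types (P Q : set R) (f : R).

(* Unlike [idealr_closed], this allows the improper ideal [setT], which is a
   monomial ideal. *)
Definition is_ideal Q : Prop :=
  [/\ Q 0, forall a b, Q a -> Q b -> Q (a + b) & forall r a, Q a -> Q (r * a)].

Definition ideal_gen (S : set R) : set R := smallest is_ideal S.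

Definition ideal_add P Q : set R := [set f + g | f in P & g in Q].

Definition ideal_mul P Q : set R := ideal_gen [set f * g | f in P & g in Q].

Definition ideal_exp Q (t : nat) : set R := iter t (ideal_mul Q) setT.

Definition ideal_scale f Q : set R := [set f * g | g in Q].

Definition ideal_adjoin Q f : set R := ideal_add Q [set f * r | r in setT].

Definition ideal_colon Q f : set R := [set r | Q (r * f)].

Definition prime_ideal P : Prop :=
  [/\ is_ideal P, ~ P 1 & forall a b, P (a * b) -> P a \/ P b].

Definition Ass Q : set (set R) :=
  [set P | prime_ideal P /\ exists f, P = ideal_colon Q f].

End Ideals.

Section MonomialIdeals.
Variables (K : fieldType) (n : nat).
Implicit Types (I : set {mpoly K[n]}) (G : set 'X_{1..n}).

(* Monomials are represented by their exponent vectors. *)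
Definition monomials G : set {mpoly K[n]} := [set 'X_[m] | m in G].

Definition mon_generates G I : Prop := I = ideal_gen (monomials G).

Definition monomial_ideal I : Prop := exists G, mon_generates G I.

Definition min_mon_generates G I : Prop :=
  mon_generates G I /\ forall G', G' `<=` G -> mon_generates G' I -> G' = G.

(* For a monomial ideal I, exactly one set G satisfies [min_mon_generates G I]:
   it consists of the monomials of I that are minimal for divisibility. *)
Definition min_gens I : set 'X_{1..n} := get [set G | min_mon_generates G I].

Definition supp_mon (m : 'X_{1..n}) : set 'I_n := [set i | (U_(i) <= m)%MM].

Definition supp_ideal I : set 'I_n := \bigcup_(v in min_gens I) supp_mon v.

Definition irrelevant_ideal : set {mpoly K[n]} :=
  ideal_gen (range (fun i : 'I_n => 'X_i)).

End MonomialIdeals.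

Arguments irrelevant_ideal : clear implicits.

(* Main.v *)
Require Import Defs.
From mathcomp Require Import all_boot all_order all_algebra.
From mathcomp Require Import mpoly.
From mathcomp Require Import boolp classical_sets.
Set Implicit Arguments.
Unset Strict Implicit.
Unset Printing Implicit Defensive.
Import GRing.Theory.
Local Open Scope ring_scope.
Local Open Scope classical_set_scope.

(** The polynomials of a monomial ideal are those all of whose monomials are
    divisible by a generator, so membership, sums, products and powers of
    monomial ideals reduce to combinatorics of exponent vectors.

    In these terms, [m] is associated to a monomial ideal [Q] exactly when
    some monomial [w] outside [Q] has all its multiples [x_i w] in [Q]
    ([Ass_irrelevantP]): if [m = (Q : f)], then any monomial of [f] outside
    [Q] will do.

    Take such a [w] for [Q = L^t].  It suffices that [u^t] does not divide [w],
    for then [w] also lies outside [(L^t, u^t)] and still witnesses [m].  Since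
    [I] and [J] are generated by monomials coprime to [u], a generator of
    [L^t] has exponent at most [t u_i] in every variable [x_i] dividing [u]
    ([exp_gens_bounded]).  As [u] is not [1], there is such an [x_i].  Suppose
    that [u^t] divides [w].  The generator of [L^t] that divides [x_i w] has
    exponent at most [t u_i <= w_i] in [x_i], so it already divides [w]
    ([multiples_drop_var]), contradicting that [w] is not in [L^t]. *)

(** * Divisibility by a set of monomials *)

Section Multiples.
Variable n : nat.
Implicit Types (G H : set 'X_{1..n}) (u m w : 'X_{1..n}).

Definition multiples G : set 'X_{1..n} := [set m | exists2 g, G g & (g <= m)%MM].

Definition sum_gens G H : set 'X_{1..n} :=
  [set m | exists g h, [/\ G g, H h & m = (g + h)%MM]].

Definition exp_gens G (t : nat) : set 'X_{1..n} := iter t (sum_gens G) [set 0%MM].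

Definition minimal_gens G : set 'X_{1..n} :=
  [set g | G g /\ forall h, G h -> (h <= g)%MM -> h = g].

Lemma mem_multiples G g : G g -> multiples G g.
Proof. by move=> Gg; exists g => //; apply: lepm_refl. Qed.

Lemma le_multiples G m m' : (m <= m')%MM -> multiples G m -> multiples G m'.
Proof. by move=> le_m [g Gg le_g]; exists g => //; apply: lepm_trans le_m. Qed.

Lemma multiples_sum G H m m' :
  multiples G m -> multiples H m' -> multiples (sum_gens G H) (m + m')%MM.
Proof.
move=> [g Gg /mnm_lepP le_g] [h Hh /mnm_lepP le_h].
exists (g + h)%MM; first by exists g, h.
by apply/mnm_lepP=> i; rewrite !mnmDE leq_add.
Qed.

(** Proper divisors have smaller degree, so every descent through divisors in
    [G] ends at a minimal generator. *)
Lemma multiples_minimal_gens G : multiples (minimal_gens G) = multiples G.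
Proof.
apply/seteqP; split=> [m [g [Gg _] le_g]|m [g Gg le_gm]]; first by exists g.
elim: {g}(mdeg g).+1 {-2}g (ltnSn (mdeg g)) Gg le_gm => // d IHd g lt_gd Gg le_gm.
have [min_g|] := pselect (forall h, G h -> (h <= g)%MM -> h = g); first by exists g.
move=> /existsNP[h /not_implyP[Gh /not_implyP[le_hg neq_hg]]].
apply: (IHd h) => //; last exact: lepm_trans le_gm.
rewrite -(submK le_hg) mdegD ltnS in lt_gd.
apply: leq_trans lt_gd; rewrite -addn1 addnC leq_add2r lt0n mdeg_eq0.
by apply/negP=> /eqP gh0; apply: neq_hg; rewrite -(submK le_hg) gh0 add0m.
Qed.

Lemma exp_gens_bounded G u i t :
  (forall g, G g -> (g i <= u i)%N) ->
  forall g, exp_gens G t g -> (g i <= (u *+ t)%MM i)%N.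
Proof.
move=> G_le; elim: t => [|t IHt] g; first by move=> ->; rewrite mnm0E.
by move=> [g1 [g2 [/G_le le1 /IHt le2 ->]]]; rewrite mulmS !mnmDE leq_add.
Qed.

(** The extra factor [x_i] only raises the exponent of [x_i], where [w] already
    dominates every generator. *)
Lemma multiples_drop_var G w i :
  (forall g, G g -> (g i <= w i)%N) -> multiples G (w + U_(i))%MM -> multiples G w.
Proof.
move=> G_le [g Gg /mnm_lepP le_g]; exists g => //; apply/mnm_lepP=> j.
have [<-|neq_ij] := eqVneq i j; first exact: G_le.
by have := le_g j; rewrite mnmDE mnm1E (negPf neq_ij) addn0.
Qed.

End Multiples.

(** * Monomial ideals and their generators *)

Section MonoIdeal.
Variables (K : fieldType) (n : nat).
Implicit Types (G H : set 'X_{1..n}) (u m w : 'X_{1..n}).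
Implicit Types (P Q I : set {mpoly K[n]}) (f : {mpoly K[n]}).

(** Membership in the ideal generated by the monomials in [G], in a form that
    can be tested term by term; the two agree by [ideal_genE]. *)
Definition mono_ideal G : set {mpoly K[n]} :=
  [set f | forall m, m \in msupp f -> multiples G m].

Lemma mono_idealX G m : mono_ideal G 'X_[m] <-> multiples G m.
Proof.
split=> [|Gm m']; first by apply; rewrite msuppX mem_seq1.
by rewrite msuppX mem_seq1 => /eqP->.
Qed.

Lemma mono_ideal_is_ideal G : is_ideal (mono_ideal G).
Proof.
split=> [m|f g If Ig m|f g Ig m]; first by rewrite msupp0.
  by move=> /msuppD_le; rewrite mem_cat => /orP[/If|/Ig].
move=> /msuppM_le /allpairsP[[m1 m2] /= [_ /Ig Gm2 ->]].
exact: le_multiples (lem_addl _ _) Gm2.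
Qed.

(** A polynomial of [mono_ideal G] is the sum of its terms, and each of them is
    a multiple of a monomial in [G]. *)
Lemma mono_ideal_sub G P :
  is_ideal P -> monomials G `<=` P -> mono_ideal G `<=` P.
Proof.
move=> [P0 PD PM] GP f If; rewrite (mpolyE f) big_seq.
elim/big_ind: _ => // m /If[g Gg le_gm].
rewrite -mul_mpolyC -(submK le_gm) mpolyXD mulrA.
by apply: PM; apply: GP; exists g.
Qed.

Lemma ideal_genE G : ideal_gen (monomials G) = mono_ideal G :> set {mpoly K[n]}.
Proof.
apply/seteqP; split.
  apply: smallest_sub; first exact: mono_ideal_is_ideal.
  by move=> _ [g Gg <-]; apply/mono_idealX/mem_multiples.
move=> f If P [Pid GP]; exact: mono_ideal_sub If.
Qed.

Lemma mono_ideal_multiples G H :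
  mono_ideal G = mono_ideal H <-> multiples G = multiples H.
Proof.
split=> [eqGH|eqGH]; last by rewrite /mono_ideal eqGH.
by apply/seteqP; split=> m /mono_idealX; rewrite (eqGH, =^~ eqGH) => /mono_idealX.
Qed.

(** The divisibility-minimal generators witness that the set chosen by
    [min_gens] exists. *)
Lemma min_gensP I : monomial_ideal I -> I = mono_ideal (min_gens I).
Proof.
move=> [G]; rewrite /mon_generates ideal_genE => defI.
suff ex_min : exists H, min_mon_generates H I.
  by have [] := getPex ex_min; rewrite /mon_generates ideal_genE.
exists (minimal_gens G); split.
  rewrite /mon_generates ideal_genE defI.
  by apply/mono_ideal_multiples; rewrite multiples_minimal_gens.
move=> H sHG; rewrite /mon_generates ideal_genE defI => /mono_ideal_multiples eqGH.
apply/seteqP; split=> // g [Gg min_g].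
have [h Hh le_hg] : multiples H g.
  by rewrite -eqGH; apply: mem_multiples.
by rewrite -(min_g h) //; have [] := sHG h Hh.
Qed.

Lemma mono_ideal_add G H :
  ideal_add (mono_ideal G) (mono_ideal H) = mono_ideal (G `|` H).
Proof.
have [[G0 GD GM] [H0 HD HM]] := (mono_ideal_is_ideal G, mono_ideal_is_ideal H).
apply/seteqP; split.
  move=> _ [f If [g Ig <-]]; have [_ + _] := mono_ideal_is_ideal (G `|` H).
  by apply=> m => [/If|/Ig] [h Hh le_h]; exists h => //; [left|right].
apply: mono_ideal_sub => [|_ [m [Gm|Hm] <-]].
- split; first by exists 0 => //; exists 0 => //; rewrite addr0.
    move=> _ _ [f If [g Ig <-]] [f' If' [g' Ig' <-]].
    by exists (f + f'); [exact: GD | exists (g + g'); [exact: HD | rewrite addrACA]].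
  move=> r _ [f If [g Ig <-]].
  by exists (r * f); [exact: GM | exists (r * g); [exact: HM | rewrite mulrDr]].
- exists 'X_[m]; first by apply/mono_idealX/mem_multiples.
  by exists 0; rewrite ?addr0.
exists 0 => //; exists 'X_[m]; last by rewrite add0r.
by apply/mono_idealX/mem_multiples.
Qed.

Lemma mono_ideal_mul G H :
  ideal_mul (mono_ideal G) (mono_ideal H) = mono_ideal (sum_gens G H).
Proof.
apply/seteqP; split.
  apply: smallest_sub; first exact: mono_ideal_is_ideal.
  move=> _ [f If [g Ig <-]] m /msuppM_le /allpairsP[[m1 m2] /= [/If Gm1 /Ig Hm2 ->]].
  exact: multiples_sum.
move=> f If P [Pid GHP]; apply: mono_ideal_sub If => // _ [_ [g [h [Gg Hh ->]]] <-].
apply: GHP; exists 'X_[g]; first exact/mono_idealX/mem_multiples.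
by exists 'X_[h]; [exact/mono_idealX/mem_multiples | rewrite mpolyXD].
Qed.

Lemma mono_ideal_setT : mono_ideal [set 0%MM] = setT.
Proof.
apply/seteqP; split=> // f _ m _; exists 0%MM => //.
by apply/mnm_lepP=> i; rewrite mnm0E.
Qed.

Lemma mono_ideal_exp G t : ideal_exp (mono_ideal G) t = mono_ideal (exp_gens G t).
Proof.
elim: t => [|t IHt]; first by rewrite mono_ideal_setT.
by rewrite /ideal_exp /= -/(ideal_exp _ t) IHt mono_ideal_mul.
Qed.

Lemma mono_ideal_scale u G :
  ideal_scale 'X_[u] (mono_ideal G) = mono_ideal (sum_gens [set u] G).
Proof.
have [G0 GD GM] := mono_ideal_is_ideal G.
apply/seteqP; split.
  move=> _ [f If <-] m /msuppM_le /allpairsP[[m1 m2] /= [m1u /If Gm2 ->]].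
  apply: multiples_sum Gm2; move: m1u; rewrite msuppX mem_seq1 => /eqP->.
  exact: mem_multiples.
apply: mono_ideal_sub => [|_ [_ [_ [g [-> Gg ->]]] <-]].
  split; first by exists 0 => //; rewrite mulr0.
    by move=> _ _ [f If <-] [g Ig <-]; exists (f + g); [exact: GD | rewrite mulrDr].
  by move=> r _ [f If <-]; exists (r * f); [exact: GM | rewrite mulrCA].
by exists 'X_[g]; [exact/mono_idealX/mem_multiples | rewrite mpolyXD].
Qed.

Lemma mono_ideal_adjoin G u :
  ideal_adjoin (mono_ideal G) 'X_[u] = mono_ideal (G `|` [set u]).
Proof.
rewrite /ideal_adjoin -/(ideal_scale _ _) -mono_ideal_setT mono_ideal_scale.
rewrite mono_ideal_add; congr (mono_ideal (G `|` _)); apply/seteqP; split.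
  by move=> _ [_ [_ [-> -> ->]]]; rewrite addm0.
by move=> _ ->; exists u, 0%MM; rewrite addm0.
Qed.

(** * Associatedness of the irrelevant ideal *)

Lemma irrelevant_idealP f : irrelevant_ideal K n f <-> f@_0%MM = 0.
Proof.
have -> : irrelevant_ideal K n = mono_ideal (range (fun i => U_(i)%MM)).
  rewrite /irrelevant_ideal -ideal_genE; congr ideal_gen.
  apply/seteqP; split=> [_ [i _ <-]|_ [_ [i _ <-] <-]].
    by exists U_(i)%MM => //; exists i.
  by exists i.
split=> [If|f0 m].
  apply/eqP; rewrite -[_ == 0]negbK -mcoeff_msupp; apply/negP=> /If[_ [i _ <-]].
  by move=> /mnm_lepP/(_ i); rewrite mnm1E mnm0E eqxx.
rewrite mcoeff_msupp => fm; have [i m_i] : exists i, m i != 0%N.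
  apply: contra_notP (negP fm) => m0; suff -> : m = 0%MM by rewrite f0.
  apply/mnmP=> i; rewrite mnm0E; apply/eqP.
  by apply: contra_notT m0 => m_i; exists i.
exists U_(i)%MM; first by exists i.
by apply/mnm_lepP=> j; rewrite mnm1E; case: eqP => [<-|]; rewrite ?lt0n.
Qed.

Lemma irrelevant_ideal_prime : prime_ideal (irrelevant_ideal K n).
Proof.
split; first split.
- by apply/irrelevant_idealP; rewrite mcoeff0.
- move=> f g /irrelevant_idealP f0 /irrelevant_idealP g0.
  by apply/irrelevant_idealP; rewrite mcoeffD f0 g0 addr0.
- move=> r f /irrelevant_idealP f0.
  by apply/irrelevant_idealP; rewrite rmorphM /= f0 mulr0.
- by move=> /irrelevant_idealP/eqP; rewrite mcoeff1 eqxx oner_eq0.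
move=> f g /irrelevant_idealP/eqP; rewrite rmorphM mulf_eq0.
by move=> /orP[]/eqP fg0; [left|right]; apply/irrelevant_idealP.
Qed.

(** From left to right, [w] is a monomial outside the ideal of a polynomial [f]
    whose colon ideal is the irrelevant one.  Conversely, [(mono_ideal G : w)]
    contains every variable and, if [r] has a constant term, the monomial [w]
    of [r w] prevents [r] from lying in it. *)
Lemma Ass_irrelevantP G :
  Ass (mono_ideal G) (irrelevant_ideal K n) <->
  exists2 w, ~ multiples G w & forall i, multiples G (w + U_(i))%MM.
Proof.
split=> [[[_ not1 _] [f defm]]|[w Gw Gwi]].
  have /existsNP[w /not_implyP[fw Gw]] : ~ mono_ideal G f.
    by move=> If; apply: not1; rewrite defm /ideal_colon /= mul1r.
  exists w => // i; have : irrelevant_ideal K n 'X_i.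
    by apply/irrelevant_idealP; rewrite mcoeffX mnm1_eq0.
  rewrite defm /ideal_colon /= mulrC => Ifi; apply: Ifi.
  by rewrite mcoeff_msupp addmC mcoeffMX -mcoeff_msupp.
split; first exact: irrelevant_ideal_prime.
exists 'X_[w]; apply/seteqP; split=> r.
  apply: (@smallest_sub _ _ _ (ideal_colon (mono_ideal G) 'X_[w])).
    have [I0 ID IM] := mono_ideal_is_ideal G; split.
    - by rewrite /ideal_colon /= mul0r.
    - by move=> a b; rewrite /ideal_colon /= mulrDl; apply: ID.
    - by move=> a b; rewrite /ideal_colon /= -mulrA; apply: IM.
  move=> _ [i _ <-]; rewrite /ideal_colon /= -mpolyXD addmC.
  exact/mono_idealX.
move=> Irw; apply/irrelevant_idealP/eqP; apply: contra_notT Gw => r0.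
by apply: Irw; rewrite mcoeff_msupp; move: r0; rewrite -(mcoeffMX r w) addm0.
Qed.

End MonoIdeal.

Theorem lemma3p9 (K : fieldType) (n : nat)
    (u : 'X_{1..n}) (I J L : set {mpoly K[n]})
    (hI : monomial_ideal I) (hJ : monomial_ideal J) (hu : u <> 0%MM)
    (hL : L = ideal_add (ideal_scale 'X_[u] I) J)
    (hsupp : supp_mon u `&` (supp_ideal I `|` supp_ideal J) = set0)
    (t : nat) (ht : (1 <= t)%N) :
  Ass (ideal_exp L t) (irrelevant_ideal K n) ->
  Ass (ideal_adjoin (ideal_exp L t) ('X_[u] ^+ t)) (irrelevant_ideal K n).
Proof.
have [i u_i] : exists i, u i != 0%N.
  apply: contra_notP hu => u0; apply/mnmP=> i; rewrite mnm0E; apply/eqP.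
  by apply: contra_notT u0 => u_i; exists i.
have supp_i (v : 'X_{1..n}) : v i != 0%N -> supp_mon v i.
  by move=> v_i; apply/mnm_lepP=> j; rewrite mnm1E; case: eqP => [<-|]; rewrite ?lt0n.
have off_supp g : min_gens I g \/ min_gens J g -> g i = 0%N.
  move=> Gg; apply/eqP; apply: contraPT hsupp => g_i.
  apply/eqP/set0P; exists i; split; first exact: supp_i.
  by case: Gg => Gg; [left|right]; exists g => //; apply: supp_i.
pose G := sum_gens [set u] (min_gens I) `|` min_gens J.
have -> : L = mono_ideal G.
  by rewrite hL {1}(min_gensP hI) {1}(min_gensP hJ) mono_ideal_scale mono_ideal_add.
rewrite mpolyXn mono_ideal_exp mono_ideal_adjoin.
have Gt_le : forall g, exp_gens G t g -> (g i <= (u *+ t)%MM i)%N.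
  apply: exp_gens_bounded => g [[_ [h [-> Ih ->]]]|Jg].
    by rewrite mnmDE (off_supp h) ?addn0 //; left.
  by rewrite off_supp //; right.
move=> /Ass_irrelevantP[w not_w w_var]; apply/Ass_irrelevantP; exists w; last first.
  by move=> j; have [g Gg le_g] := w_var j; exists g => //; left.
move=> [g [Gg|->] le_g]; first by apply: not_w; exists g.
apply: not_w; apply: (multiples_drop_var (i := i)) (w_var i) => g' /Gt_le le_g'.
by apply: leq_trans le_g' _; move: le_g => /mnm_lepP.
Qed.
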